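(* The category $\mathbf{Cxt}$ of formal contexts and closed relations coincides with the category of formal contexts and compatible relations (of Moshier and Jipsen), when a closed relation $R\colon G_1\to G_2$ is identified with its bond $B\subseteq G_1\times M_2$, $B(g)=R(g)'$. In particular, for any formal contexts $\mathbb{K}_1,\mathbb{K}_2$, a relation $B\subseteq G_1\times M_2$ is a compatible relation if and only if it is a bond.
   Context: A formal context is $\mathbb{K}=(G,M,\models)$ with sets $G,M$ and $\models\ \subseteq G\times M$. For $A\subseteq G$: $A'=\{m\in M\mid a\models m\ \forall a\in A\}$; for $B\subseteq M$: $B'=\{g\in G\mid g\models b\ \forall b\in B\}$. Closure: $\overline{A}=A''$; $A$ is closed if $A=\overline{A}$. For a relation $R\subseteq X\times Y$ (written $R\colon X\to Y$): $R^\dagger\colon Y\to X$ is the converse; $R(A)=\{y\mid\exists a\in A,\ R(a,y)\}$, $R(x)=R(\{x\})$; $R^\bullet(Z)=\{x\in X\mid R(x)\subseteq Z\}$ for $Z\subseteq Y$; $R_\bullet(A)=\{y\in Y\mid R(x,y)\ \forall x\in A\}$ for $A\subseteq X$. $\mathbf{Cxt}$: objects are formal contexts; morphisms $\mathbb{K}_1\to\mathbb{K}_2$ are closed relations $R\colon G_1\to G_2$, meaning every $R(g)$ is closed and $R^\bullet$ preserves closed sets; composition $(S\circ R)(g)=\overline{S(R(g))}$, identity $g\mapsto\overline{\{g\}}$. A bond from $\mathbb{K}_1$ to $\mathbb{K}_2$ is a relation $B\subseteq G_1\times M_2$ such that $B(g_1)\subseteq M_2$ and $B^\dagger(m_2)\subseteq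 G_1$ are closed for all $g_1\in G_1$, $m_2\in M_2$. The assignment $R\mapsto B$, $B(g)=R(g)'$, with inverse $R(g)=B(g)'$, is a bijection between closed relations $G_1\to G_2$ and bonds $G_1\to M_2$. Category of Moshier and Jipsen: objects are formal contexts; morphisms $\mathbb{K}_1\to\mathbb{K}_2$ are compatible relations, i.e. relations $B\subseteq G_1\times M_2$ such that $C=B^\dagger$ satisfies $\overline{C_\bullet(Y)}=C_\bullet(Y)=C_\bullet(\overline{Y})$ for all $Y\subseteq M_2$. The composite of $B_1\subseteq G_1\times M_2$ and $B_2\subseteq G_2\times M_3$, with $C_i=B_i^\dagger$, is the relation $B_2\bullet B_1\subseteq G_1\times M_3$ with $(B_2\bullet B_1)^\dagger(m)=(C_1)_\bullet\big(((C_2)_\bullet(\{m\}))'\big)$ for $m\in M_3$; the identity on $\mathbb{K}$ is $\models$. *)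

(* Defs.v *)
From mathcomp Require Import ssreflect ssrfun ssrbool boolp classical_sets.
Set Implicit Arguments.
Unset Strict Implicit.
Unset Printing Implicit Defensive.
Local Open Scope classical_set_scope.

(* A relation from X to Y is a function [R : X -> set Y], so that [R x] is the *)
(* set written R(x) and [R x y] says that x is related to y.                   *)
Section Relations.
Variables X Y : Type.
Implicit Type R : X -> set Y.

Definition converse R : Y -> set X := fun y => [set x | R x y].

Definition rel_image R (A : set X) : set Y := \bigcup_(a in A) R a.

(* The sets written with the bullet as superscript, resp. subscript, of R;     *)
(* in particular [sub_bullet R set0 = setT].                                   *)
Definition sup_bullet R (Z : set Y) : set X := [set x | R x `<=` Z].

Definition sub_bullet R (A : set X) : set Y :=
  [set y | forall x, A x -> R x y].

End Relations.

Record context := Context {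
  obj : Type;
  attr : Type;
  incidence : obj -> set attr }.

Section Derivation.
Variable K : context.

Definition attrs_of (A : set (obj K)) : set (attr K) :=
  [set m | forall a, A a -> incidence a m].

Definition objs_of (B : set (attr K)) : set (obj K) :=
  [set g | forall b, B b -> incidence g b].

Definition obj_closure (A : set (obj K)) := objs_of (attrs_of A).
Definition attr_closure (B : set (attr K)) := attrs_of (objs_of B).

Definition obj_closed (A : set (obj K)) := A = obj_closure A.
Definition attr_closed (B : set (attr K)) := B = attr_closure B.

End Derivation.

Definition is_closed_rel (K1 K2 : context) (R : obj K1 -> set (obj K2)) :=
  (forall g, obj_closed (R g)) /\
  (forall Z, obj_closed Z -> obj_closed (sup_bullet R Z)).

Definition is_bond (K1 K2 : context) (B : obj K1 -> set (attr K2)) :=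
  (forall g, attr_closed (B g)) /\ (forall m, obj_closed (converse B m)).

Definition is_compatible (K1 K2 : context) (B : obj K1 -> set (attr K2)) :=
  forall Y : set (attr K2),
    obj_closure (sub_bullet (converse B) Y) = sub_bullet (converse B) Y /\
    sub_bullet (converse B) Y = sub_bullet (converse B) (attr_closure Y).

Definition bond_of (K1 K2 : context) (R : obj K1 -> set (obj K2)) :
    obj K1 -> set (attr K2) :=
  fun g => attrs_of (R g).

Definition cxt_comp (K1 K2 K3 : context) (S : obj K2 -> set (obj K3))
    (R : obj K1 -> set (obj K2)) : obj K1 -> set (obj K3) :=
  fun g => obj_closure (rel_image S (R g)).

Definition cxt_id (K : context) : obj K -> set (obj K) :=
  fun g => obj_closure [set g].

(* Moshier and Jipsen's composition, defined through the converse relations.   *)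
Definition mj_comp (K1 K2 K3 : context) (B2 : obj K2 -> set (attr K3))
    (B1 : obj K1 -> set (attr K2)) : obj K1 -> set (attr K3) :=
  converse (fun m => sub_bullet (converse B1)
                       (attrs_of (sub_bullet (converse B2) [set m]))).

Definition mj_id (K : context) : obj K -> set (attr K) := @incidence K.

Record closed_rel (K1 K2 : context) := ClosedRel {
  closed_rel_fun :> obj K1 -> set (obj K2);
  closed_relP : is_closed_rel closed_rel_fun }.

Record compatible_rel (K1 K2 : context) := CompatibleRel {
  compatible_rel_fun :> obj K1 -> set (attr K2);
  compatible_relP : is_compatible compatible_rel_fun }.

(* The collection of objects is a parameter, so that two categories can share  *)
(* their objects on the nose.                                                  *)
Record category (Ob : Type) := Category {
  hom :> Ob -> Ob -> Type;
  idm : forall x, hom x x;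
  comp : forall x y z, hom y z -> hom x y -> hom x z;
  comp_idl : forall x y (f : hom x y), comp (idm y) f = f;
  comp_idr : forall x y (f : hom x y), comp f (idm x) = f;
  compA : forall x y z t (h : hom z t) (g : hom y z) (f : hom x y),
    comp h (comp g f) = comp (comp h g) f }.

Arguments idm {Ob} c x.
Arguments comp {Ob} c {x y z} _ _.

Record id_on_obj_functor (Ob : Type) (C D : category Ob) := IdOnObjFunctor {
  fmap :> forall x y, C x y -> D x y;
  fmap_id : forall x, fmap (idm C x) = idm D x;
  fmap_comp : forall x y z (g : C y z) (f : C x y),
    fmap (comp C g f) = comp D (fmap g) (fmap f) }.

Arguments fmap {Ob C D} _ {x y} _.

Definition is_iso_functor (Ob : Type) (C D : category Ob)
    (F : id_on_obj_functor C D) :=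
  exists F' : id_on_obj_functor D C,
    (forall x y (f : C x y), fmap F' (fmap F f) = f) /\
    (forall x y (f : D x y), fmap F (fmap F' f) = f).

Section DerivationTheory.
Variable K : context.
Implicit Types (A : set (obj K)) (B : set (attr K)).

Lemma attrs_ofS A A' : A `<=` A' -> attrs_of A' `<=` attrs_of A.
Proof. by move=> sAA' m hm a /sAA'; apply: hm. Qed.

Lemma objs_ofS B B' : B `<=` B' -> objs_of B' `<=` objs_of B.
Proof. by move=> sBB' m hm a /sBB'; apply: hm. Qed.

Lemma sub_obj_closure A : A `<=` obj_closure A.
Proof. by move=> a Aa m; apply. Qed.

Lemma sub_attr_closure B : B `<=` attr_closure B.
Proof. by move=> b Bb g; apply. Qed.

Lemma attrs_of_closure A : attrs_of (obj_closure A) = attrs_of A.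
Proof.
by apply/seteqP; split; [exact/attrs_ofS/sub_obj_closure|exact: sub_attr_closure].
Qed.

Lemma objs_of_closure B : objs_of (attr_closure B) = objs_of B.
Proof.
by apply/seteqP; split; [exact/objs_ofS/sub_attr_closure|exact: sub_obj_closure].
Qed.

Lemma objs_of_closed B : obj_closed (objs_of B).
Proof. by rewrite /obj_closed -[in LHS]objs_of_closure. Qed.

Lemma obj_closureS A A' : A `<=` A' -> obj_closure A `<=` obj_closure A'.
Proof. by move=> /attrs_ofS/objs_ofS. Qed.

Lemma obj_closure_min A A' :
  obj_closed A' -> A `<=` A' -> obj_closure A `<=` A'.
Proof. by move=> -> /obj_closureS; rewrite /obj_closure attrs_of_closure. Qed.

Lemma obj_closedP A : obj_closure A `<=` A -> obj_closed A.
Proof. by move=> h; apply/seteqP; split=> //; exact: sub_obj_closure. Qed.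

End DerivationTheory.

Section ClosedRelations.
Variables K1 K2 K3 : context.

Lemma rel_image_closure (R : obj K1 -> set (obj K2)) A : is_closed_rel R ->
  rel_image R (obj_closure A) `<=` obj_closure (rel_image R A).
Proof.
move=> [_ hR] y [x xA Rxy].
suff: sup_bullet R (obj_closure (rel_image R A)) x by apply.
apply: obj_closure_min xA; first by apply: hR; exact: objs_of_closed.
by move=> a Aa z Raz; apply: sub_obj_closure; exists a.
Qed.

Lemma cxt_comp_closed (S : obj K2 -> set (obj K3)) (R : obj K1 -> set (obj K2)) :
  is_closed_rel S -> is_closed_rel R -> is_closed_rel (cxt_comp S R).
Proof.
move=> [_ hS] [_ hR]; split=> [g|Z cZ]; first exact: objs_of_closed.
suff -> : sup_bullet (cxt_comp S R) Z = sup_bullet R (sup_bullet S Z).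
  by apply: hR; apply: hS.
apply/seteqP; split=> g hg.
  by move=> y Rgy z Syz; apply: hg; apply: sub_obj_closure; exists y.
by apply: obj_closure_min => // z [y Rgy Syz]; exact: (hg y).
Qed.

Lemma cxt_id_closed (K : context) : is_closed_rel (@cxt_id K).
Proof.
split=> [g|Z cZ]; first exact: objs_of_closed.
suff -> : sup_bullet (@cxt_id K) Z = Z by [].
apply/seteqP; split=> g hg; first by apply: hg; exact: sub_obj_closure.
by apply: obj_closure_min => // _ ->.
Qed.

End ClosedRelations.

Section CompatibleRelations.
Variables K1 K2 K3 : context.

Lemma sub_bullet1 (X Y : Type) (R : X -> set Y) x : sub_bullet R [set x] = R x.
Proof. by apply/seteqP; split=> y hy; [exact: hy|move=> _ ->]. Qed.

Lemma sub_bullet_mj_comp (B2 : obj K2 -> set (attr K3))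
    (B1 : obj K1 -> set (attr K2)) (Y : set (attr K3)) :
  is_compatible B2 -> is_compatible B1 ->
  sub_bullet (converse (mj_comp B2 B1)) Y =
  sub_bullet (converse B1) (attrs_of (sub_bullet (converse B2) Y)).
Proof.
move=> h2 h1.
pose U := \bigcup_(m in Y) attrs_of (sub_bullet (converse B2) [set m]).
transitivity (sub_bullet (converse B1) U).
  apply/seteqP; split=> g hg; first by move=> n [m Ym hn]; exact: (hg m Ym).
  by move=> m Ym n hn; apply: hg; exists m.
rewrite (h1 U).2 /attr_closure; congr (sub_bullet _ (attrs_of _)).
apply/seteqP; split=> x hx.
  move=> m Ym; rewrite -[converse B2 m]sub_bullet1 -(h2 [set m]).1.
  by move=> n hn; apply: hx; exists m.
by move=> n [m Ym]; apply => _ ->; exact: hx.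
Qed.

Lemma mj_comp_compatible (B2 : obj K2 -> set (attr K3))
    (B1 : obj K1 -> set (attr K2)) :
  is_compatible B2 -> is_compatible B1 -> is_compatible (mj_comp B2 B1).
Proof.
move=> h2 h1 Y; rewrite !sub_bullet_mj_comp//; split; first exact: (h1 _).1.
by rewrite (h2 Y).2.
Qed.

Lemma mj_id_compatible (K : context) : is_compatible (@mj_id K).
Proof.
move=> Y; split; first exact/esym/(objs_of_closed Y).
exact/esym/(objs_of_closure Y).
Qed.

End CompatibleRelations.

Lemma closed_rel_eq (K1 K2 : context) (R S : closed_rel K1 K2) :
  (R : obj K1 -> set (obj K2)) = S -> R = S.
Proof.
by case: R S => [R hR] [S hS] /= e; subst S; rewrite (Prop_irrelevance hR hS).
Qed.

Lemma compatible_rel_eq (K1 K2 : context) (B C : compatible_rel K1 K2) :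
  (B : obj K1 -> set (attr K2)) = C -> B = C.
Proof.
by case: B C => [B hB] [C hC] /= e; subst C; rewrite (Prop_irrelevance hB hC).
Qed.

Definition closed_rel_id (K : context) : closed_rel K K :=
  ClosedRel (@cxt_id_closed K).

Definition closed_rel_comp (K1 K2 K3 : context)
    (S : closed_rel K2 K3) (R : closed_rel K1 K2) : closed_rel K1 K3 :=
  ClosedRel (cxt_comp_closed (closed_relP S) (closed_relP R)).

Definition compatible_rel_id (K : context) : compatible_rel K K :=
  CompatibleRel (@mj_id_compatible K).

Definition compatible_rel_comp (K1 K2 K3 : context)
    (B2 : compatible_rel K2 K3) (B1 : compatible_rel K1 K2) :
    compatible_rel K1 K3 :=
  CompatibleRel (mj_comp_compatible (compatible_relP B2) (compatible_relP B1)).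

Lemma closed_rel_comp_idl (K1 K2 : context) (R : closed_rel K1 K2) :
  closed_rel_comp (closed_rel_id K2) R = R.
Proof.
apply: closed_rel_eq; apply/funext => g; have [cR _] := closed_relP R.
apply/seteqP; split=> [|y Ry].
  apply: obj_closure_min => // y [x Rx]; apply: obj_closure_min => //.
  by move=> _ ->.
by apply: sub_obj_closure; exists y => //; apply: sub_obj_closure.
Qed.

Lemma closed_rel_comp_idr (K1 K2 : context) (R : closed_rel K1 K2) :
  closed_rel_comp R (closed_rel_id K1) = R.
Proof.
apply: closed_rel_eq; apply/funext => g; have [cR _] := closed_relP R.
apply/seteqP; split=> [|y Ry].
  apply: obj_closure_min => // y /(rel_image_closure (closed_relP R)).
  by apply: obj_closure_min => // {}y [_ ->].
by apply: sub_obj_closure; exists g => //; apply: sub_obj_closure.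
Qed.

Lemma closed_rel_compA (K1 K2 K3 K4 : context) (T : closed_rel K3 K4)
    (S : closed_rel K2 K3) (R : closed_rel K1 K2) :
  closed_rel_comp T (closed_rel_comp S R) =
  closed_rel_comp (closed_rel_comp T S) R.
Proof.
apply: closed_rel_eq; apply/funext => g; apply/seteqP; split.
  apply: obj_closure_min; first exact: objs_of_closed.
  move=> t /(rel_image_closure (closed_relP T)).
  apply: obj_closureS => {}t [z [y Ry Sz] Tt].
  by exists y => //; apply: sub_obj_closure; exists z.
apply: obj_closure_min; first exact: objs_of_closed.
move=> t [y Ry]; apply: obj_closureS => {}t [z Sz Tt].
by exists z => //; apply: sub_obj_closure; exists y.
Qed.

Lemma compatible_rel_comp_idl (K1 K2 : context) (B : compatible_rel K1 K2) :
  compatible_rel_comp (compatible_rel_id K2) B = B.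
Proof.
apply: compatible_rel_eq; apply/funext => g; apply/seteqP; split=> m hm.
  rewrite -[B g m]/(converse B m g) -sub_bullet1.
  by rewrite (compatible_relP B [set m]).2.
have: converse B m g by [].
by rewrite -sub_bullet1 (compatible_relP B [set m]).2.
Qed.

Lemma compatible_rel_comp_idr (K1 K2 : context) (B : compatible_rel K1 K2) :
  compatible_rel_comp B (compatible_rel_id K1) = B.
Proof.
apply: compatible_rel_eq; apply/funext => g; apply/seteqP; split=> m hm.
  rewrite -[B g m]/(converse B m g) -sub_bullet1.
  by rewrite -(compatible_relP B [set m]).1.
have: converse B m g by [].
by rewrite -sub_bullet1 -(compatible_relP B [set m]).1.
Qed.

Lemma compatible_rel_compA (K1 K2 K3 K4 : context) (B3 : compatible_rel K3 K4)
    (B2 : compatible_rel K2 K3) (B1 : compatible_rel K1 K2) :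
  compatible_rel_comp B3 (compatible_rel_comp B2 B1) =
  compatible_rel_comp (compatible_rel_comp B3 B2) B1.
Proof.
have [c1 c2 c3] : [/\ is_compatible B1, is_compatible B2 & is_compatible B3].
  by split; exact: compatible_relP.
apply: compatible_rel_eq; apply/funext => g; apply/funext => m.
transitivity (sub_bullet (converse B1) (attrs_of (sub_bullet (converse B2)
    (attrs_of (sub_bullet (converse B3) [set m])))) g).
  by rewrite -sub_bullet_mj_comp.
by rewrite -(sub_bullet_mj_comp [set m] c3 c2).
Qed.

Definition Cxt : category context :=
  Category closed_rel_comp_idl closed_rel_comp_idr closed_rel_compA.

Definition MJCxt : category context :=
  Category compatible_rel_comp_idl compatible_rel_comp_idr compatible_rel_compA.

(* Main.v *)
Require Import Defs.
From mathcomp Require Import ssreflect ssrfun ssrbool boolp classical_sets.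

(** Everything rests on the Galois connection between [attrs_of] and [objs_of].
    The set [sub_bullet (converse B) Y] consists of the [g] with
    [Y `<=` B g]; hence it is an intersection of columns of [B], and it is
    insensitive to closing [Y] exactly when the rows of [B] are closed. For
    [B = bond_of R], the column of [m] is [sup_bullet R (objs_of [set m])], and
    for closed [Z] one has [sup_bullet R Z = sub_bullet (converse B) (attrs_of Z)],
    which makes closed relations and bonds correspond. *)

Set Implicit Arguments.
Unset Strict Implicit.
Unset Printing Implicit Defensive.
Local Open Scope classical_set_scope.

Lemma sub_attrs_of (K : context) (A : set (obj K)) (B : set (attr K)) :
  (B `<=` attrs_of A) <-> (A `<=` objs_of B).
Proof. by split=> [h a Aa b /h|h b Bb a /h]; apply. Qed.

Lemma attrs_of_closed (K : context) (A : set (obj K)) :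
  attr_closed (attrs_of A).
Proof. by rewrite /attr_closed /attr_closure -/(obj_closure A) attrs_of_closure. Qed.

Lemma attr_closure_min (K : context) (B B' : set (attr K)) :
  attr_closed B' -> B `<=` B' -> attr_closure B `<=` B'.
Proof. by move=> -> /objs_ofS/attrs_ofS; rewrite /attr_closure objs_of_closure. Qed.

(** The Galois connection turns the left side into an inclusion of [A] in the closure of [D], which
    is [D] itself. *)
Lemma sub_attrs_of_closed (K : context) (A D : set (obj K)) :
  obj_closed D -> (attrs_of D `<=` attrs_of A) <-> (A `<=` D).
Proof. by move=> cD; rewrite sub_attrs_of [in X in _ <-> X]cD. Qed.

Section CompatibleBond.
Variables (K1 K2 : context) (B : obj K1 -> set (attr K2)).

(** Two instances of compatibility suffice: [Y := B g] closes the row of [g], and [Y := [set m]]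
    closes the column of [m]. *)
Lemma compatible_bond : is_compatible B -> is_bond B.
Proof.
move=> cB; split=> [g|m].
  apply/seteqP; split; first exact: sub_attr_closure.
  have: sub_bullet (converse B) (B g) g by [].
  by rewrite (cB (B g)).2.
by have [/esym + _] := cB [set m]; rewrite sub_bullet1.
Qed.

Lemma bond_compatible : is_bond B -> is_compatible B.
Proof.
move=> [rowB colB] Y; split.
  apply/esym/obj_closedP => g hg m Ym.
  by move: g hg; apply: obj_closure_min => // g; exact.
apply/seteqP; split=> g hg; first exact: (attr_closure_min (rowB g)).
by move=> m /sub_attr_closure; exact: hg.
Qed.

End CompatibleBond.

Lemma bond_of_bond (K1 K2 : context) (R : obj K1 -> set (obj K2)) :
  is_closed_rel R -> is_bond (bond_of R).
Proof.
move=> [_ hR]; split=> [g|m]; first exact: attrs_of_closed.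
suff -> : converse (bond_of R) m = sup_bullet R (objs_of [set m]).
  by apply: hR; exact: objs_of_closed.
apply/seteqP; split=> g hg; first by move=> y Ry _ ->; exact: hg.
by move=> y Ry; exact: (hg y Ry m).
Qed.

(** The inverse of [bond_of], once restricted to bonds. *)
Definition rel_of (K1 K2 : context) (B : obj K1 -> set (attr K2)) :
    obj K1 -> set (obj K2) :=
  fun g => objs_of (B g).

Lemma rel_of_closed (K1 K2 : context) (B : obj K1 -> set (attr K2)) :
  is_bond B -> is_closed_rel (rel_of B).
Proof.
move=> bB; split=> [g|Z cZ]; first exact: objs_of_closed.
suff -> : sup_bullet (rel_of B) Z = sub_bullet (converse B) (attrs_of Z).
  by apply/esym; exact: (bond_compatible bB (attrs_of Z)).1.
(* Derivation reverses inclusions, and deriving twice gives back the closed sets [B g] and [Z]. *)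
apply/seteqP; split=> g /=.
  by move=> /attrs_ofS; rewrite -/(attr_closure (B g)) -(bB.1 g).
by move=> /objs_ofS; rewrite -/(obj_closure Z) -cZ.
Qed.

Lemma bond_ofK (K1 K2 : context) (R : obj K1 -> set (obj K2)) :
  is_closed_rel R -> rel_of (bond_of R) = R.
Proof. by move=> [cR _]; apply/funext => g; exact/esym/cR. Qed.

Lemma rel_ofK (K1 K2 : context) (B : obj K1 -> set (attr K2)) :
  is_bond B -> bond_of (rel_of B) = B.
Proof. by move=> [rowB _]; apply/funext => g; exact/esym/rowB. Qed.

Lemma bond_of_id (K : context) : bond_of (@cxt_id K) = @mj_id K.
Proof.
apply/funext => g; rewrite /bond_of /cxt_id attrs_of_closure.
by apply/seteqP; split=> m hm; [exact: hm|move=> _ ->].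
Qed.

(** Both sides relate [g] to [m] exactly when [R g] lies in the column of [m] in [bond_of S]. The
    right side states this inclusion after applying [attrs_of], which is equivalent because the
    column is closed. *)
Lemma bond_of_comp (K1 K2 K3 : context) (S : obj K2 -> set (obj K3))
    (R : obj K1 -> set (obj K2)) : is_closed_rel S ->
  bond_of (cxt_comp S R) = mj_comp (bond_of S) (bond_of R).
Proof.
move=> cS; apply/funext => g; rewrite /bond_of /cxt_comp attrs_of_closure.
have colS := (bond_of_bond cS).2.
apply/seteqP; split=> m hm.
  rewrite /mj_comp /converse /= sub_bullet1.
  apply/(sub_attrs_of_closed (R g) (colS m)) => y Ry z Sz.
  by apply: hm; exists y.
move: hm; rewrite /mj_comp /converse /= sub_bullet1.
move=> /(sub_attrs_of_closed (R g) (colS m)) hm z [y Ry Sz].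
exact: (hm y Ry).
Qed.

(** Functoriality of [G] comes for free: write each morphism of [D] as an image under [F], use that
    [F] preserves identities and composites, then cancel. *)
Lemma bijective_iso_functor (Ob : Type) (C D : category Ob)
    (F : id_on_obj_functor C D) (G : forall x y, D x y -> C x y) :
  (forall x y (f : C x y), G x y (fmap F f) = f) ->
  (forall x y (f : D x y), fmap F (G x y f) = f) ->
  is_iso_functor F.
Proof.
move=> FK GK.
have G_id x : G x x (idm D x) = idm C x by rewrite -(fmap_id F) FK.
have G_comp x y z (g : D y z) (f : D x y) :
    G x z (Defs.comp D g f) = Defs.comp C (G y z g) (G x y f).
  by rewrite -{1}(GK _ _ g) -{1}(GK _ _ f) -fmap_comp FK.
by exists (IdOnObjFunctor G_id G_comp).
Qed.

Definition bond_map (K1 K2 : context) (R : Cxt K1 K2) : MJCxt K1 K2 :=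
  CompatibleRel (bond_compatible (bond_of_bond (closed_relP R))).

Definition rel_map (K1 K2 : context) (B : MJCxt K1 K2) : Cxt K1 K2 :=
  ClosedRel (rel_of_closed (compatible_bond (compatible_relP B))).

Lemma bond_map_id (K : context) : bond_map (idm Cxt K) = idm MJCxt K.
Proof. by apply: compatible_rel_eq; exact: bond_of_id. Qed.

Lemma bond_map_comp (K1 K2 K3 : context) (S : Cxt K2 K3) (R : Cxt K1 K2) :
  bond_map (Defs.comp Cxt S R) = Defs.comp MJCxt (bond_map S) (bond_map R).
Proof. by apply: compatible_rel_eq; exact/bond_of_comp/closed_relP. Qed.

Definition bond_functor : id_on_obj_functor Cxt MJCxt :=
  IdOnObjFunctor bond_map_id bond_map_comp.

Theorem lemma16 :
  (exists F : id_on_obj_functor Cxt MJCxt,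
     is_iso_functor F /\
     forall (K1 K2 : context) (R : closed_rel K1 K2),
       (fmap F R : compatible_rel K1 K2) = bond_of R
         :> (obj K1 -> set (attr K2))) /\
  (forall (K1 K2 : context) (B : obj K1 -> set (attr K2)),
     is_compatible B <-> is_bond B).
Proof.
split; last by split; [exact: compatible_bond|exact: bond_compatible].
(* The formula for [fmap F R] holds by computation. *)
exists bond_functor; split=> //.
apply: (bijective_iso_functor (G := rel_map)) => K1 K2 f.
  by apply: closed_rel_eq; exact/bond_ofK/closed_relP.
by apply: compatible_rel_eq; exact/rel_ofK/compatible_bond/compatible_relP.
Qed.
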